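(* Let $s=3$. The coefficients of an explicit $3$-stage stochastic Runge-Kutta (SRK) method satisfy all the order two conditions 1.--59. listed in the context (order $p_D=p_S=2$) if and only if, up to a relabelling of the third family of stages (i.e. after applying one common permutation of $\{1,2,3\}$ to the entries of $\beta^{(3)}$, the entries of $\beta^{(4)}$, the rows of $A^{(2)}$ and the rows of $B^{(2)}$, columns not being permuted), they are of the following form. There are $c_1\in\{-1,1\}$ and $c_2,c_3,c_4,c_5\in\mathbb{R}$ with $c_3\ne0$, $c_4\neq 0$ such that $${\beta^{(1)}}^T=\begin{bmatrix}c_1-\frac{c_1}{2c_3^2}&\frac{c_1}{4c_3^2}&\frac{c_1}{4c_3^2}\end{bmatrix},\quad {\beta^{(2)}}^T=\begin{bmatrix}0&\frac1{2c_3}&-\frac1{2c_3}\end{bmatrix},$$ $${\beta^{(3)}}^T=\begin{bmatrix}-\frac{c_1}{2c_4^2}&\frac{c_1}{4c_4^2}&\frac{c_1}{4c_4^2}\end{bmatrix},\quad {\beta^{(4)}}^T=\begin{bmatrix}0&\frac1{2c_4}&-\frac1{2c_4}\end{bmatrix},$$ $$A^{(1)}=\begin{bmatrix}0&0&0\\c_3^2&0&0\\c_3^2-c_2&c_2&0\end{bmatrix},\quad B^{(1)}=\begin{bmatrix}0&0&0\\c_3&0&0\\-c_3&0&0\end{bmatrix},\quad B^{(2)}=\begin{bmatrix}0&0&0\\c_4+2c_5&-c_5&-c_5\\-c_4-2c_5&c_5&c_5\end{bmatrix},$$ and $\alpha,B^{(0)},A^{(0)},A^{(2)}$ are given by one of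 the following families (F1)--(F12), with real parameters $c_6,c_7,\dots$; in (F1)--(F3) $c_2\in\mathbb{R}$ is arbitrary, while in (F4)--(F12) $c_2=0$. (F1) $\alpha^T=\begin{bmatrix}\frac12-c_{11}&c_{11}&\frac12\end{bmatrix}$, $B^{(0)}=\begin{bmatrix}0&0&0\\0&0&0\\c_1&0&0\end{bmatrix}$, $A^{(0)}=\begin{bmatrix}0&0&0\\0&0&0\\c_{12}&1-c_{12}&0\end{bmatrix}$, $A^{(2)}=\begin{bmatrix}c_6-c_7&c_7&c_8\\c_6-c_9&c_9&c_8\\c_6-c_{10}&c_{10}&c_8\end{bmatrix}$. (F2) $c_{10}\ne0$, $\alpha^T=\begin{bmatrix}\frac12-c_{10}&c_{10}&\frac12\end{bmatrix}$, $B^{(0)}=\begin{bmatrix}0&0&0\\0&0&0\\c_1&0&0\end{bmatrix}$, $A^{(0)}=\begin{bmatrix}0&0&0\\\frac{1-c_{11}}{2c_{10}}&0&0\\c_{11}-c_{12}&c_{12}&0\end{bmatrix}$, $A^{(2)}=\begin{bmatrix}c_6-c_7&c_7&c_8\\c_6-c_9&c_9&c_8\\c_6-c_9&c_9&c_8\end{bmatrix}$. (F3) $\alpha^T=\begin{bmatrix}\frac12&0&\frac12\end{bmatrix}$, $B^{(0)}=\begin{bmatrix}0&0&0\\0&0&0\\c_1&0&0\end{bmatrix}$, $A^{(0)}=\begin{bmatrix}0&0&0\\c_{10}&0&0\\1-c_{11}&c_{11}&0\end{bmatrix}$, $A^{(2)}=\begin{bmatrix}c_6-c_7&c_7&c_8\\c_6-c_9&c_9&c_8\\c_6-c_9&c_9&c_8\end{bmatrix}$.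 (F4) $c_9\ne c_{10}$, $\alpha^T=\begin{bmatrix}\frac12-c_{11}&\frac12&c_{11}\end{bmatrix}$, $B^{(0)}=\begin{bmatrix}0&0&0\\c_1&0&0\\0&0&0\end{bmatrix}$, $A^{(0)}=\begin{bmatrix}0&0&0\\1&0&0\\c_{12}&-c_{12}&0\end{bmatrix}$, $A^{(2)}=\begin{bmatrix}c_6-c_8&c_7&c_8\\c_6-c_9&c_7&c_9\\c_6-c_{10}&c_7&c_{10}\end{bmatrix}$. (F5) $\alpha^T=\begin{bmatrix}\frac12-c_{10}&\frac12&c_{10}\end{bmatrix}$, $B^{(0)}=\begin{bmatrix}0&0&0\\c_1&0&0\\0&0&0\end{bmatrix}$, $A^{(0)}=\begin{bmatrix}0&0&0\\1-2c_{10}c_{11}&0&0\\c_{11}-c_{12}&c_{12}&0\end{bmatrix}$, $A^{(2)}=\begin{bmatrix}c_6-c_8&c_7&c_8\\c_6-c_9&c_7&c_9\\c_6-c_9&c_7&c_9\end{bmatrix}$. (F6) $c_8\neq c_9$, $\alpha^T=\begin{bmatrix}\frac12&\frac12&0\end{bmatrix}$, $B^{(0)}=\begin{bmatrix}0&0&0\\c_1&0&0\\c_{10}&-c_{10}&0\end{bmatrix}$, $A^{(0)}=\begin{bmatrix}0&0&0\\1&0&0\\c_{11}&-c_{11}&0\end{bmatrix}$, $A^{(2)}=\begin{bmatrix}c_6-c_8&c_7&c_8\\c_6-c_9&c_7&c_9\\c_6-2c_8+c_9&c_7&2c_8-c_9\end{bmatrix}$. (F7) $\alpha^T=\begin{bmatrix}\frac12&\frac12&0\end{bmatrix}$,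 $B^{(0)}=\begin{bmatrix}0&0&0\\c_1&0&0\\c_9-c_{10}&c_{10}&0\end{bmatrix}$, $A^{(0)}=\begin{bmatrix}0&0&0\\1&0&0\\c_{11}&c_{12}&0\end{bmatrix}$, $A^{(2)}=\begin{bmatrix}c_6&c_7&c_8\\c_6&c_7&c_8\\c_6&c_7&c_8\end{bmatrix}$. (F8) $c_9\ne c_{10}$, $\alpha^T=\begin{bmatrix}\frac12&\frac12-c_{11}&c_{11}\end{bmatrix}$, $B^{(0)}=\begin{bmatrix}0&0&0\\c_1&0&0\\c_1&0&0\end{bmatrix}$, $A^{(0)}=\begin{bmatrix}0&0&0\\1&0&0\\1-c_{12}&c_{12}&0\end{bmatrix}$, $A^{(2)}=\begin{bmatrix}c_6&c_7&c_8\\c_6&c_9&c_7+c_8-c_9\\c_6&c_{10}&c_7+c_8-c_{10}\end{bmatrix}$. (F9) $c_{10}\neq\frac12$, $\alpha^T=\begin{bmatrix}\frac12&\frac12-c_{10}&c_{10}\end{bmatrix}$, $B^{(0)}=\begin{bmatrix}0&0&0\\c_1&0&0\\c_1&0&0\end{bmatrix}$, $A^{(0)}=\begin{bmatrix}0&0&0\\\frac{1-2c_{10}c_{11}}{1-2c_{10}}&0&0\\c_{11}-c_{12}&c_{12}&0\end{bmatrix}$, $A^{(2)}=\begin{bmatrix}c_6&c_7&c_8\\c_6&c_9&c_7+c_8-c_9\\c_6&c_9&c_7+c_8-c_9\end{bmatrix}$. (F10) $c_{10}\ne0$, $\alpha^T=\begin{bmatrix}\frac12&0&\frac12\end{bmatrix}$,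 $B^{(0)}=\begin{bmatrix}0&0&0\\c_{10}&0&0\\c_1&0&0\end{bmatrix}$, $A^{(0)}=\begin{bmatrix}0&0&0\\c_{11}&0&0\\1-c_{12}&c_{12}&0\end{bmatrix}$, $A^{(2)}=\begin{bmatrix}c_6+(c_9-c_7)(1-\frac{c_1}{c_{10}})&c_8+(c_9-c_7)\frac{c_1}{c_{10}}&c_7\\c_6&c_8&c_9\\c_6&c_8&c_9\end{bmatrix}$. (F11) $c_7\ne c_9$, $\alpha^T=\begin{bmatrix}\frac12&\frac12&0\end{bmatrix}$, $B^{(0)}=\begin{bmatrix}0&0&0\\c_1&0&0\\c_1-c_{10}&c_{10}&0\end{bmatrix}$, $A^{(0)}=\begin{bmatrix}0&0&0\\1&0&0\\1-c_{11}&c_{11}&0\end{bmatrix}$, $A^{(2)}=\begin{bmatrix}c_6&c_7&c_8\\c_6&c_9&c_7+c_8-c_9\\c_6&2c_7-c_9&c_9+c_8-c_7\end{bmatrix}$. (F12) $0\ne c_{10}\ne c_{11}\ne0$, $c_{11}\neq c_1$, $\alpha^T=\begin{bmatrix}1+\frac{1-c_1(c_{10}+c_{11})}{2c_{10}c_{11}}&\frac12\frac{1-c_1c_{11}}{c_{10}(c_{10}-c_{11})}&-\frac12\frac{1-c_1c_{10}}{c_{11}(c_{10}-c_{11})}\end{bmatrix}$, $B^{(0)}=\begin{bmatrix}0&0&0\\c_{10}&0&0\\c_{11}&0&0\end{bmatrix}$, $A^{(0)}=\begin{bmatrix}0&0&0\\\frac{c_{10}}{c_{11}}\frac{c_{11}(c_{11}-c_{10})-c_{12}(1-c_1c_{10})}{c_1c_{11}-1}&0&0\\c_{12}-c_{13}&c_{13}&0\end{bmatrix}$,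 $A^{(2)}=\begin{bmatrix}c_6+(c_9-c_7)(1-\frac{c_{11}}{c_{10}})&c_8+(c_9-c_7)\frac{c_{11}}{c_{10}}&c_7\\c_6&c_8&c_9\\c_6&c_8&c_9\end{bmatrix}$.
   Context: The coefficients of an explicit $s$-stage SRK method (for the weak approximation of It\^o SDEs) are vectors $\alpha,\beta^{(1)},\beta^{(2)},\beta^{(3)},\beta^{(4)}\in\mathbb{R}^s$ and matrices $A^{(q)},B^{(q)}\in\mathbb{R}^{s\times s}$, $q=0,1,2$, where $A^{(q)}_{ij}=B^{(q)}_{ij}=0$ for $j\ge i$ and $q\in\{0,1\}$; no restriction is imposed on $A^{(2)}$, $B^{(2)}$. The rows of $A^{(2)},B^{(2)}$ and the entries of $\beta^{(3)},\beta^{(4)}$ are indexed by the third family of stages. Let $e=(1,\dots,1)^T\in\mathbb{R}^s$. Powers and products of column vectors are component-wise. $p_S$ denotes the weak order for SDEs and $p_D$ the order for ODEs (zero diffusion). Order two conditions: 1. $\alpha^Te=1$ 2. ${\beta^{(4)}}^Te=0$ 3. ${\beta^{(3)}}^Te=0$ 4. $({\beta^{(1)}}^Te)^2=1$ 5. ${\beta^{(2)}}^Te=0$ 6. ${\beta^{(1)}}^TB^{(1)}e=0$ 7. ${\beta^{(4)}}^TA^{(2)}e=0$ 8. ${\beta^{(3)}}^TB^{(2)}e=0$ 9. ${\beta^{(4)}}^T(B^{(2)}e)^2=0$ 10. $\alpha^TA^{(0)}e=\frac12$ 11. $\alpha^T(B^{(0)}e)^2=\frac12$ 12. $({\beta^{(1)}}^Te)(\alpha^TB^{(0)}e)=\frac12$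 13. $({\beta^{(1)}}^Te)({\beta^{(1)}}^TA^{(1)}e)=\frac12$ 14. ${\beta^{(3)}}^TA^{(2)}e=0$ 15. ${\beta^{(2)}}^TB^{(1)}e=1$ 16. ${\beta^{(4)}}^TB^{(2)}e=1$ 17. $({\beta^{(1)}}^Te)({\beta^{(1)}}^T(B^{(1)}e)^2)=\frac12$ 18. $({\beta^{(1)}}^Te)({\beta^{(3)}}^T(B^{(2)}e)^2)=\frac12$ 19. ${\beta^{(1)}}^T(B^{(1)}(B^{(1)}e))=0$ 20. ${\beta^{(3)}}^T(B^{(2)}(B^{(1)}e))=0$ 21. ${\beta^{(3)}}^T(B^{(2)}(B^{(1)}(B^{(1)}e)))=0$ 22. ${\beta^{(1)}}^T(A^{(1)}(B^{(0)}e))=0$ 23. ${\beta^{(3)}}^T(A^{(2)}(B^{(0)}e))=0$ 24. ${\beta^{(4)}}^T(A^{(2)}e)^2=0$ 25. ${\beta^{(4)}}^T(A^{(2)}(A^{(0)}e))=0$ 26. $\alpha^T(B^{(0)}(B^{(1)}e))=0$ 27. ${\beta^{(2)}}^TA^{(1)}e=0$ 28. ${\beta^{(1)}}^T((A^{(1)}e)(B^{(1)}e))=0$ 29. ${\beta^{(3)}}^T((A^{(2)}e)(B^{(2)}e))=0$ 30. ${\beta^{(4)}}^T(A^{(2)}(B^{(0)}e))=0$ 31. ${\beta^{(2)}}^T(A^{(1)}(B^{(0)}e))=0$ 32. ${\beta^{(4)}}^T((B^{(2)}e)^2(A^{(2)}e))=0$ 33. ${\beta^{(4)}}^T(A^{(2)}(B^{(0)}e)^2)=0$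 34. ${\beta^{(2)}}^T(A^{(1)}(B^{(0)}e)^2)=0$ 35. ${\beta^{(1)}}^T(B^{(1)}(A^{(1)}e))=0$ 36. ${\beta^{(3)}}^T(B^{(2)}(A^{(1)}e))=0$ 37. ${\beta^{(2)}}^T(B^{(1)}e)^2=0$ 38. ${\beta^{(4)}}^T(B^{(2)}(B^{(1)}e))=0$ 39. ${\beta^{(2)}}^T(B^{(1)}(B^{(1)}e))=0$ 40. ${\beta^{(1)}}^T(B^{(1)}e)^3=0$ 41. ${\beta^{(3)}}^T(B^{(2)}e)^3=0$ 42. ${\beta^{(1)}}^T(B^{(1)}(B^{(1)}e)^2)=0$ 43. ${\beta^{(3)}}^T(B^{(2)}(B^{(1)}e)^2)=0$ 44. ${\beta^{(4)}}^T(B^{(2)}e)^4=0$ 45. ${\beta^{(4)}}^T(B^{(2)}(B^{(1)}e))^2=0$ 46. ${\beta^{(4)}}^T((B^{(2)}e)(B^{(2)}(B^{(1)}e)))=0$ 47. $\alpha^T((B^{(0)}e)(B^{(0)}(B^{(1)}e)))=0$ 48. ${\beta^{(1)}}^T((A^{(1)}(B^{(0)}e))(B^{(1)}e))=0$ 49. ${\beta^{(3)}}^T((A^{(2)}(B^{(0)}e))(B^{(2)}e))=0$ 50. ${\beta^{(1)}}^T(A^{(1)}(B^{(0)}(B^{(1)}e)))=0$ 51. ${\beta^{(3)}}^T(A^{(2)}(B^{(0)}(B^{(1)}e)))=0$ 52. ${\beta^{(4)}}^T((B^{(2)}(A^{(1)}e))(B^{(2)}e))=0$ 53. ${\beta^{(1)}}^T(B^{(1)}(A^{(1)}(B^{(0)}e)))=0$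 54. ${\beta^{(3)}}^T(B^{(2)}(A^{(1)}(B^{(0)}e)))=0$ 55. ${\beta^{(1)}}^T((B^{(1)}e)(B^{(1)}(B^{(1)}e)))=0$ 56. ${\beta^{(3)}}^T((B^{(2)}e)(B^{(2)}(B^{(1)}e)))=0$ 57. ${\beta^{(1)}}^T(B^{(1)}(B^{(1)}(B^{(1)}e)))=0$ 58. ${\beta^{(4)}}^T((B^{(2)}e)(B^{(2)}(B^{(1)}e)^2))=0$ 59. ${\beta^{(4)}}^T((B^{(2)}e)(B^{(2)}(B^{(1)}(B^{(1)}e))))=0$ *)

(* Defs.v *)
From HB Require Import structures.
From mathcomp Require Import all_boot all_order all_algebra.
From mathcomp Require Import fingroup perm.
From mathcomp Require Import reals.

Set Implicit Arguments.
Unset Strict Implicit.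
Unset Printing Implicit Defensive.

Import Order.TTheory GRing.Theory Num.Theory.

Local Open Scope ring_scope.

Reserved Notation "u ⊙ v" (at level 40, left associativity).
Reserved Notation "u ⊙^ n" (at level 29, left associativity).

Definition hadamard (R : realType) (s : nat) (u v : 'cV[R]_s) : 'cV[R]_s :=
  \col_i (u i 0 * v i 0).

Definition hadamardX (R : realType) (s : nat) (u : 'cV[R]_s) (n : nat) :
  'cV[R]_s := \col_i (u i 0 ^+ n).

Notation "u ⊙ v" := (hadamard u v) : ring_scope.
Notation "u ⊙^ n" := (hadamardX u n) : ring_scope.

(* u^T v as a scalar rather than as a 1 x 1 matrix. *)
Definition dotv (R : realType) (s : nat) (u v : 'cV[R]_s) : R :=
  (u^T *m v) 0 0.

Record srk (R : realType) (s : nat) := SRK {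
  alpha : 'cV[R]_s;
  beta1 : 'cV[R]_s;
  beta2 : 'cV[R]_s;
  beta3 : 'cV[R]_s;
  beta4 : 'cV[R]_s;
  A0 : 'M[R]_s;
  A1 : 'M[R]_s;
  A2 : 'M[R]_s;
  B0 : 'M[R]_s;
  B1 : 'M[R]_s;
  B2 : 'M[R]_s
}.

Definition strictly_lower (R : realType) (s : nat) (A : 'M[R]_s) : Prop :=
  forall i j : 'I_s, (i <= j)%N -> A i j = 0.

(* A2 and B2 are deliberately unrestricted. *)
Definition explicit_srk (R : realType) (s : nat) (M : srk R s) : Prop :=
  [/\ strictly_lower (A0 M), strictly_lower (A1 M),
      strictly_lower (B0 M) & strictly_lower (B1 M)].

Record order_two_conditions (R : realType) (s : nat)
    (a b1 b2 b3 b4 : 'cV[R]_s) (A0 A1 A2 B0 B1 B2 : 'M[R]_s)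
    (e : 'cV[R]_s) : Prop := OrderTwoConditions {
  cond1 : dotv a e = 1;
  cond2 : dotv b4 e = 0;
  cond3 : dotv b3 e = 0;
  cond4 : (dotv b1 e) ^+ 2 = 1;
  cond5 : dotv b2 e = 0;
  cond6 : dotv b1 (B1 *m e) = 0;
  cond7 : dotv b4 (A2 *m e) = 0;
  cond8 : dotv b3 (B2 *m e) = 0;
  cond9 : dotv b4 ((B2 *m e) ⊙^ 2) = 0;
  cond10 : dotv a (A0 *m e) = 1 / 2;
  cond11 : dotv a ((B0 *m e) ⊙^ 2) = 1 / 2;
  cond12 : dotv b1 e * dotv a (B0 *m e) = 1 / 2;
  cond13 : dotv b1 e * dotv b1 (A1 *m e) = 1 / 2;
  cond14 : dotv b3 (A2 *m e) = 0;
  cond15 : dotv b2 (B1 *m e) = 1;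
  cond16 : dotv b4 (B2 *m e) = 1;
  cond17 : dotv b1 e * dotv b1 ((B1 *m e) ⊙^ 2) = 1 / 2;
  cond18 : dotv b1 e * dotv b3 ((B2 *m e) ⊙^ 2) = 1 / 2;
  cond19 : dotv b1 (B1 *m (B1 *m e)) = 0;
  cond20 : dotv b3 (B2 *m (B1 *m e)) = 0;
  cond21 : dotv b3 (B2 *m (B1 *m (B1 *m e))) = 0;
  cond22 : dotv b1 (A1 *m (B0 *m e)) = 0;
  cond23 : dotv b3 (A2 *m (B0 *m e)) = 0;
  cond24 : dotv b4 ((A2 *m e) ⊙^ 2) = 0;
  cond25 : dotv b4 (A2 *m (A0 *m e)) = 0;
  cond26 : dotv a (B0 *m (B1 *m e)) = 0;
  cond27 : dotv b2 (A1 *m e) = 0;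
  cond28 : dotv b1 ((A1 *m e) ⊙ (B1 *m e)) = 0;
  cond29 : dotv b3 ((A2 *m e) ⊙ (B2 *m e)) = 0;
  cond30 : dotv b4 (A2 *m (B0 *m e)) = 0;
  cond31 : dotv b2 (A1 *m (B0 *m e)) = 0;
  cond32 : dotv b4 (((B2 *m e) ⊙^ 2) ⊙ (A2 *m e)) = 0;
  cond33 : dotv b4 (A2 *m ((B0 *m e) ⊙^ 2)) = 0;
  cond34 : dotv b2 (A1 *m ((B0 *m e) ⊙^ 2)) = 0;
  cond35 : dotv b1 (B1 *m (A1 *m e)) = 0;
  cond36 : dotv b3 (B2 *m (A1 *m e)) = 0;
  cond37 : dotv b2 ((B1 *m e) ⊙^ 2) = 0;
  cond38 : dotv b4 (B2 *m (B1 *m e)) = 0;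
  cond39 : dotv b2 (B1 *m (B1 *m e)) = 0;
  cond40 : dotv b1 ((B1 *m e) ⊙^ 3) = 0;
  cond41 : dotv b3 ((B2 *m e) ⊙^ 3) = 0;
  cond42 : dotv b1 (B1 *m ((B1 *m e) ⊙^ 2)) = 0;
  cond43 : dotv b3 (B2 *m ((B1 *m e) ⊙^ 2)) = 0;
  cond44 : dotv b4 ((B2 *m e) ⊙^ 4) = 0;
  cond45 : dotv b4 ((B2 *m (B1 *m e)) ⊙^ 2) = 0;
  cond46 : dotv b4 ((B2 *m e) ⊙ (B2 *m (B1 *m e))) = 0;
  cond47 : dotv a ((B0 *m e) ⊙ (B0 *m (B1 *m e))) = 0;
  cond48 : dotv b1 ((A1 *m (B0 *m e)) ⊙ (B1 *m e)) = 0;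
  cond49 : dotv b3 ((A2 *m (B0 *m e)) ⊙ (B2 *m e)) = 0;
  cond50 : dotv b1 (A1 *m (B0 *m (B1 *m e))) = 0;
  cond51 : dotv b3 (A2 *m (B0 *m (B1 *m e))) = 0;
  cond52 : dotv b4 ((B2 *m (A1 *m e)) ⊙ (B2 *m e)) = 0;
  cond53 : dotv b1 (B1 *m (A1 *m (B0 *m e))) = 0;
  cond54 : dotv b3 (B2 *m (A1 *m (B0 *m e))) = 0;
  cond55 : dotv b1 ((B1 *m e) ⊙ (B1 *m (B1 *m e))) = 0;
  cond56 : dotv b3 ((B2 *m e) ⊙ (B2 *m (B1 *m e))) = 0;
  cond57 : dotv b1 (B1 *m (B1 *m (B1 *m e))) = 0;
  cond58 : dotv b4 ((B2 *m e) ⊙ (B2 *m ((B1 *m e) ⊙^ 2))) = 0;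
  cond59 : dotv b4 ((B2 *m e) ⊙ (B2 *m (B1 *m (B1 *m e)))) = 0
}.

Definition order_two (R : realType) (s : nat) (M : srk R s) : Prop :=
  order_two_conditions (alpha M) (beta1 M) (beta2 M) (beta3 M) (beta4 M)
    (A0 M) (A1 M) (A2 M) (B0 M) (B1 M) (B2 M) (const_mx 1).

(* The third family of stages indexes the entries of beta3, beta4 and the rows,
   but not the columns, of A2, B2. *)
Definition relabel3 (R : realType) (s : nat) (p : 'S_s) (M : srk R s) :
    srk R s :=
  SRK (alpha M) (beta1 M) (beta2 M)
      (row_perm p (beta3 M)) (row_perm p (beta4 M))
      (A0 M) (A1 M) (row_perm p (A2 M))
      (B0 M) (B1 M) (row_perm p (B2 M)).

Definition vec3 (R : realType) (x y z : R) : 'cV[R]_3 :=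
  \col_(i < 3) nth 0 [:: x; y; z] i.

(* Entries listed row by row. *)
Definition mat3 (R : realType) (x11 x12 x13 x21 x22 x23 x31 x32 x33 : R) :
    'M[R]_3 :=
  \matrix_(i < 3, j < 3)
    nth 0 (nth [::] [:: [:: x11; x12; x13];
                        [:: x21; x22; x23];
                        [:: x31; x32; x33]] i) j.

Definition F1 (R : realType) (c1 : R) (a : 'cV[R]_3) (B0 A0 A2 : 'M[R]_3) :
    Prop :=
  exists c6 c7 c8 c9 c10 c11 c12 : R,
  [/\ a = vec3 (1 / 2 - c11) c11 (1 / 2),
      B0 = mat3 0  0 0
                0  0 0
                c1 0 0,
      A0 = mat3 0   0         0
                0   0         0
                c12 (1 - c12) 0 &
      A2 = mat3 (c6 - c7)  c7  c8
                (c6 - c9)  c9  c8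
                (c6 - c10) c10 c8].

Definition F2 (R : realType) (c1 : R) (a : 'cV[R]_3) (B0 A0 A2 : 'M[R]_3) :
    Prop :=
  exists c6 c7 c8 c9 c10 c11 c12 : R, c10 != 0 /\
  [/\ a = vec3 (1 / 2 - c10) c10 (1 / 2),
      B0 = mat3 0  0 0
                0  0 0
                c1 0 0,
      A0 = mat3 0                       0   0
                ((1 - c11) / (2 * c10)) 0   0
                (c11 - c12)             c12 0 &
      A2 = mat3 (c6 - c7) c7 c8
                (c6 - c9) c9 c8
                (c6 - c9) c9 c8].

Definition F3 (R : realType) (c1 : R) (a : 'cV[R]_3) (B0 A0 A2 : 'M[R]_3) :
    Prop :=
  exists c6 c7 c8 c9 c10 c11 : R,
  [/\ a = vec3 (1 / 2) 0 (1 / 2),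
      B0 = mat3 0  0 0
                0  0 0
                c1 0 0,
      A0 = mat3 0         0   0
                c10       0   0
                (1 - c11) c11 0 &
      A2 = mat3 (c6 - c7) c7 c8
                (c6 - c9) c9 c8
                (c6 - c9) c9 c8].

Definition F4 (R : realType) (c1 : R) (a : 'cV[R]_3) (B0 A0 A2 : 'M[R]_3) :
    Prop :=
  exists c6 c7 c8 c9 c10 c11 c12 : R, c9 != c10 /\
  [/\ a = vec3 (1 / 2 - c11) (1 / 2) c11,
      B0 = mat3 0  0 0
                c1 0 0
                0  0 0,
      A0 = mat3 0   0       0
                1   0       0
                c12 (- c12) 0 &
      A2 = mat3 (c6 - c8)  c7 c8
                (c6 - c9)  c7 c9
                (c6 - c10) c7 c10].

Definition F5 (R : realType) (c1 : R) (a : 'cV[R]_3) (B0 A0 A2 : 'M[R]_3) :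
    Prop :=
  exists c6 c7 c8 c9 c10 c11 c12 : R,
  [/\ a = vec3 (1 / 2 - c10) (1 / 2) c10,
      B0 = mat3 0  0 0
                c1 0 0
                0  0 0,
      A0 = mat3 0                   0   0
                (1 - 2 * c10 * c11) 0   0
                (c11 - c12)         c12 0 &
      A2 = mat3 (c6 - c8) c7 c8
                (c6 - c9) c7 c9
                (c6 - c9) c7 c9].

Definition F6 (R : realType) (c1 : R) (a : 'cV[R]_3) (B0 A0 A2 : 'M[R]_3) :
    Prop :=
  exists c6 c7 c8 c9 c10 c11 : R, c8 != c9 /\
  [/\ a = vec3 (1 / 2) (1 / 2) 0,
      B0 = mat3 0   0       0
                c1  0       0
                c10 (- c10) 0,
      A0 = mat3 0   0       0
                1   0       0
                c11 (- c11) 0 &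
      A2 = mat3 (c6 - c8)          c7 c8
                (c6 - c9)          c7 c9
                (c6 - 2 * c8 + c9) c7 (2 * c8 - c9)].

Definition F7 (R : realType) (c1 : R) (a : 'cV[R]_3) (B0 A0 A2 : 'M[R]_3) :
    Prop :=
  exists c6 c7 c8 c9 c10 c11 c12 : R,
  [/\ a = vec3 (1 / 2) (1 / 2) 0,
      B0 = mat3 0          0   0
                c1         0   0
                (c9 - c10) c10 0,
      A0 = mat3 0   0   0
                1   0   0
                c11 c12 0 &
      A2 = mat3 c6 c7 c8
                c6 c7 c8
                c6 c7 c8].

Definition F8 (R : realType) (c1 : R) (a : 'cV[R]_3) (B0 A0 A2 : 'M[R]_3) :
    Prop :=
  exists c6 c7 c8 c9 c10 c11 c12 : R, c9 != c10 /\
  [/\ a = vec3 (1 / 2) (1 / 2 - c11) c11,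
      B0 = mat3 0  0 0
                c1 0 0
                c1 0 0,
      A0 = mat3 0         0   0
                1         0   0
                (1 - c12) c12 0 &
      A2 = mat3 c6 c7  c8
                c6 c9  (c7 + c8 - c9)
                c6 c10 (c7 + c8 - c10)].

Definition F9 (R : realType) (c1 : R) (a : 'cV[R]_3) (B0 A0 A2 : 'M[R]_3) :
    Prop :=
  exists c6 c7 c8 c9 c10 c11 c12 : R, c10 != 1 / 2 /\
  [/\ a = vec3 (1 / 2) (1 / 2 - c10) c10,
      B0 = mat3 0  0 0
                c1 0 0
                c1 0 0,
      A0 = mat3 0                                     0   0
                ((1 - 2 * c10 * c11) / (1 - 2 * c10)) 0   0
                (c11 - c12)                           c12 0 &
      A2 = mat3 c6 c7 c8
                c6 c9 (c7 + c8 - c9)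
                c6 c9 (c7 + c8 - c9)].

Definition F10 (R : realType) (c1 : R) (a : 'cV[R]_3) (B0 A0 A2 : 'M[R]_3) :
    Prop :=
  exists c6 c7 c8 c9 c10 c11 c12 : R, c10 != 0 /\
  [/\ a = vec3 (1 / 2) 0 (1 / 2),
      B0 = mat3 0   0 0
                c10 0 0
                c1  0 0,
      A0 = mat3 0         0   0
                c11       0   0
                (1 - c12) c12 0 &
      A2 = mat3 (c6 + (c9 - c7) * (1 - c1 / c10)) (c8 + (c9 - c7) * (c1 / c10)) c7
                c6                                c8                            c9
                c6                                c8                            c9].

Definition F11 (R : realType) (c1 : R) (a : 'cV[R]_3) (B0 A0 A2 : 'M[R]_3) :
    Prop :=
  exists c6 c7 c8 c9 c10 c11 : R, c7 != c9 /\
  [/\ a = vec3 (1 / 2) (1 / 2) 0,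
      B0 = mat3 0          0   0
                c1         0   0
                (c1 - c10) c10 0,
      A0 = mat3 0         0   0
                1         0   0
                (1 - c11) c11 0 &
      A2 = mat3 c6 c7            c8
                c6 c9            (c7 + c8 - c9)
                c6 (2 * c7 - c9) (c9 + c8 - c7)].

Definition F12 (R : realType) (c1 : R) (a : 'cV[R]_3) (B0 A0 A2 : 'M[R]_3) :
    Prop :=
  exists c6 c7 c8 c9 c10 c11 c12 c13 : R,
  [/\ c10 != 0, c10 != c11, c11 != 0 & c11 != c1] /\
  [/\ a = vec3 (1 + (1 - c1 * (c10 + c11)) / (2 * c10 * c11))
               (1 / 2 * ((1 - c1 * c11) / (c10 * (c10 - c11))))
               (- (1 / 2) * ((1 - c1 * c10) / (c11 * (c10 - c11)))),
      B0 = mat3 0   0 0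
                c10 0 0
                c11 0 0,
      A0 = mat3 0 0 0
                (c10 / c11 * ((c11 * (c11 - c10) - c12 * (1 - c1 * c10))
                              / (c1 * c11 - 1))) 0 0
                (c12 - c13) c13 0 &
      A2 = mat3 (c6 + (c9 - c7) * (1 - c11 / c10)) (c8 + (c9 - c7) * (c11 / c10)) c7
                c6                                 c8                             c9
                c6                                 c8                             c9].

Definition family_c2_free (R : realType) (c1 : R) (a : 'cV[R]_3)
    (B0 A0 A2 : 'M[R]_3) : Prop :=
  F1 c1 a B0 A0 A2 \/ F2 c1 a B0 A0 A2 \/ F3 c1 a B0 A0 A2.

Definition family_c2_zero (R : realType) (c1 : R) (a : 'cV[R]_3)
    (B0 A0 A2 : 'M[R]_3) : Prop :=
  F4 c1 a B0 A0 A2 \/ F5 c1 a B0 A0 A2 \/ F6 c1 a B0 A0 A2 \/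
  F7 c1 a B0 A0 A2 \/ F8 c1 a B0 A0 A2 \/ F9 c1 a B0 A0 A2 \/
  F10 c1 a B0 A0 A2 \/ F11 c1 a B0 A0 A2 \/ F12 c1 a B0 A0 A2.

Definition classified_form (R : realType) (M : srk R 3) : Prop :=
  exists c1 c2 c3 c4 c5 : R,
  [/\ c1 = -1 \/ c1 = 1, c3 != 0 & c4 != 0] /\
  [/\ beta1 M = vec3 (c1 - c1 / (2 * c3 ^+ 2)) (c1 / (4 * c3 ^+ 2))
                     (c1 / (4 * c3 ^+ 2)),
      beta2 M = vec3 0 (1 / (2 * c3)) (- (1 / (2 * c3))),
      beta3 M = vec3 (- (c1 / (2 * c4 ^+ 2))) (c1 / (4 * c4 ^+ 2))
                     (c1 / (4 * c4 ^+ 2)) &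
      beta4 M = vec3 0 (1 / (2 * c4)) (- (1 / (2 * c4)))] /\
  [/\ A1 M = mat3 0              0  0
                  (c3 ^+ 2)      0  0
                  (c3 ^+ 2 - c2) c2 0,
      B1 M = mat3 0      0 0
                  c3     0 0
                  (- c3) 0 0 &
      B2 M = mat3 0                 0      0
                  (c4 + 2 * c5)     (- c5) (- c5)
                  (- c4 - 2 * c5)   c5     c5] /\
  (family_c2_free c1 (alpha M) (B0 M) (A0 M) (A2 M) \/
   c2 = 0 /\ family_c2_zero c1 (alpha M) (B0 M) (A0 M) (A2 M)).

(* Main.v *)
(* The conditions on [beta3], [beta4] and the nodes [g = B2 e] force [g] to be a
   permutation of [(0, c4, - c4)]: weights orthogonal to [1], [g], [g^3] but not
   to [g^2] require distinct nodes with sum [0], and nonzero weights orthogonal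
   to [1], [g^2], [g^4] require two nodes with the same square.  Relabelling
   the third family of stages moves the zero node to the first place; the
   strictly lower triangular [B1] has its zero node there already.  This
   determines all coefficients except [alpha], [A0], [A2], [B0], which are left
   with a small polynomial system, solved by splitting on which of the row sums
   [u], [v] of [B0] vanish or coincide. *)
Require Import Defs.
From HB Require Import structures.
From mathcomp Require Import all_boot all_order all_algebra.
From mathcomp Require Import fingroup perm.
From mathcomp Require Import reals.
From mathcomp Require Import ring lra.
Set Implicit Arguments.
Unset Strict Implicit.
Unset Printing Implicit Defensive.

Import Order.TTheory GRing.Theory Num.Theory.

Local Open Scope ring_scope.

(** * Coordinate calculus for vectors and matrices of size three *)

Section Coordinates.
Variable R : realType.
Implicit Types (u v : 'cV[R]_3) (A : 'M[R]_3) (x y z : R).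

Lemma ord3_ind (P : 'I_3 -> Prop) : P 0 -> P 1 -> P 2 -> forall i, P i.
Proof.
move=> P0 P1 P2 [[|[|[|//]]] lti]; [move: P0|move: P1|move: P2];
  by congr P; apply: val_inj.
Qed.

Lemma vec3_eta u : u = vec3 (u 0 0) (u 1 0) (u 2 0).
Proof. by apply/colP; elim/ord3_ind; rewrite mxE. Qed.

Lemma mat3_eta A :
  A = mat3 (A 0 0) (A 0 1) (A 0 2) (A 1 0) (A 1 1) (A 1 2)
           (A 2 0) (A 2 1) (A 2 2).
Proof. by apply/matrixP; elim/ord3_ind; elim/ord3_ind; rewrite mxE. Qed.

Lemma const_mx1_vec3 : const_mx 1 = vec3 1 1 1 :> 'cV[R]_3.
Proof. by rewrite [LHS]vec3_eta !mxE. Qed.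

Lemma hadamard_vec3 x y z x' y' z' :
  vec3 x y z ⊙ vec3 x' y' z' = vec3 (x * x') (y * y') (z * z').
Proof. by rewrite [LHS]vec3_eta !mxE. Qed.

Lemma hadamardX_vec3 x y z n :
  vec3 x y z ⊙^ n = vec3 (x ^+ n) (y ^+ n) (z ^+ n).
Proof. by rewrite [LHS]vec3_eta !mxE. Qed.

Lemma sum3 (F : 'I_3 -> R) : \sum_i F i = F 0 + F 1 + F 2.
Proof.
rewrite !big_ord_recr big_ord0 /= add0r.
by congr (F _ + F _ + F _); apply: val_inj.
Qed.

Lemma dotv_vec3 x y z x' y' z' :
  dotv (vec3 x y z) (vec3 x' y' z') = x * x' + y * y' + z * z'.
Proof. by rewrite /dotv mxE sum3 !mxE. Qed.

Lemma mul_mat3_vec3 a11 a12 a13 a21 a22 a23 a31 a32 a33 x y z :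
  mat3 a11 a12 a13 a21 a22 a23 a31 a32 a33 *m vec3 x y z =
  vec3 (a11 * x + a12 * y + a13 * z) (a21 * x + a22 * y + a23 * z)
       (a31 * x + a32 * y + a33 * z).
Proof. by rewrite [LHS]vec3_eta !mxE !sum3 !mxE. Qed.

(** The ring rules erase the zero entries of triangular matrices and collapse row sums of the form
    [y - z + z]. *)
Definition coordE :=
  (const_mx1_vec3, hadamard_vec3, hadamardX_vec3, dotv_vec3, mul_mat3_vec3,
   (mulr1, mulr0, mul0r, addr0, add0r, subrK, subrKA, expr0n)).

Lemma vec3_surj u : exists x y z, u = vec3 x y z.
Proof. by do 3!eexists; apply: vec3_eta. Qed.

(* Matrices are parametrised by their row sums, since most conditions only
   involve the products [A *m e]. *)
Lemma mat3_row_sums A : exists f1 f2 f3 m1 m2 m3 n1 n2 n3,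
  A = mat3 (f1 - m1 - n1) m1 n1 (f2 - m2 - n2) m2 n2 (f3 - m3 - n3) m3 n3.
Proof.
exists (A 0 0 + A 0 1 + A 0 2), (A 1 0 + A 1 1 + A 1 2),
  (A 2 0 + A 2 1 + A 2 2), (A 0 1), (A 1 1), (A 2 1), (A 0 2), (A 1 2), (A 2 2).
by rewrite [LHS]mat3_eta; congr mat3; ring.
Qed.

Lemma strictly_lower_row_sums A : strictly_lower A ->
  exists x y z, A = mat3 0 0 0 x 0 0 (y - z) z 0.
Proof.
move=> lowA; exists (A 1 0), (A 2 0 + A 2 1), (A 2 1).
by rewrite addrK {1}[A]mat3_eta !(lowA 0) ?(lowA 1 1) ?(lowA 1 2) ?(lowA 2 2).
Qed.

Lemma vec3_inj x y z x' y' z' :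
  vec3 x y z = vec3 x' y' z' -> [/\ x = x', y = y' & z = z'].
Proof.
by move=> E; split; [have := congr1 (fun u : 'cV_3 => u 0 0) E |
  have := congr1 (fun u : 'cV_3 => u 1 0) E |
  have := congr1 (fun u : 'cV_3 => u 2 0) E]; rewrite !mxE.
Qed.

Lemma mat3_inj (a11 a12 a13 a21 a22 a23 a31 a32 a33
               b11 b12 b13 b21 b22 b23 b31 b32 b33 : R) :
  mat3 a11 a12 a13 a21 a22 a23 a31 a32 a33 =
    mat3 b11 b12 b13 b21 b22 b23 b31 b32 b33 ->
  [/\ [/\ a11 = b11, a12 = b12 & a13 = b13],
      [/\ a21 = b21, a22 = b22 & a23 = b23] &
      [/\ a31 = b31, a32 = b32 & a33 = b33]].
Proof.
move=> E; have Eij i j := congr1 (fun A : 'M_3 => A i j) E.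
by repeat split; [move: (Eij 0 0)|move: (Eij 0 1)|move: (Eij 0 2)|
  move: (Eij 1 0)|move: (Eij 1 1)|move: (Eij 1 2)|
  move: (Eij 2 0)|move: (Eij 2 1)|move: (Eij 2 2)]; rewrite !mxE.
Qed.

End Coordinates.

(** * Invariance under relabelling of the third family of stages *)

Section Relabelling.
Variables (R : realType) (s : nat) (p : 'S_s).
Implicit Types (u v : 'cV[R]_s) (A : 'M[R]_s).

Lemma dotv_row_perm u v : dotv (row_perm p u) (row_perm p v) = dotv u v.
Proof.
rewrite /dotv !mxE [RHS](reindex_inj (@perm_inj _ p)) /=.
by apply: eq_bigr => i _; rewrite !mxE.
Qed.

Lemma mulmx_row_perm A u : row_perm p A *m u = row_perm p (A *m u).
Proof. by rewrite !row_permE mulmxA. Qed.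

Lemma hadamard_row_perm u v :
  row_perm p u ⊙ row_perm p v = row_perm p (u ⊙ v).
Proof. by apply/colP => i; rewrite !mxE. Qed.

Lemma hadamardX_row_perm u n : row_perm p u ⊙^ n = row_perm p (u ⊙^ n).
Proof. by apply/colP => i; rewrite !mxE. Qed.

Lemma row_perm_const x : row_perm p (const_mx x) = const_mx x :> 'cV[R]_s.
Proof. by apply/colP => i; rewrite !mxE. Qed.

(** [beta3] and [beta4] are only paired with vectors built componentwise from [e] and from products
    with [A2] or [B2] on the left. These are permuted along with them, and [e] is fixed. *)
Lemma order_two_relabel3 (M : srk R s) :
  order_two (relabel3 p M) <-> order_two M.
Proof.
have E u : dotv (row_perm p u) (const_mx 1) = dotv u (const_mx 1).
  by rewrite -{1}(row_perm_const 1) dotv_row_perm.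
by split; case; rewrite /= ?(mulmx_row_perm, hadamard_row_perm,
  hadamardX_row_perm, dotv_row_perm, E) => *; split;
  rewrite /= ?(mulmx_row_perm, hadamard_row_perm,
  hadamardX_row_perm, dotv_row_perm, E).
Qed.

End Relabelling.

(** * Moment problems for three nodes *)

Section Nodes.
Variable R : realType.

(** Testing [r] on products of node factors shows that the nodes are distinct and sum to 0. Were
    none of them zero, their squares would be distinct too, and the same interpolation in the
    squares would make [t1], [t2], [t3] vanish, against the first moment 1. *)
Lemma exists_zero_node (r1 r2 r3 t1 t2 t3 g1 g2 g3 : R) :
  r1 + r2 + r3 = 0 -> r1 * g1 + r2 * g2 + r3 * g3 = 0 ->
  r1 * g1 ^+ 2 + r2 * g2 ^+ 2 + r3 * g3 ^+ 2 != 0 ->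
  r1 * g1 ^+ 3 + r2 * g2 ^+ 3 + r3 * g3 ^+ 3 = 0 ->
  t1 + t2 + t3 = 0 -> t1 * g1 + t2 * g2 + t3 * g3 = 1 ->
  t1 * g1 ^+ 2 + t2 * g2 ^+ 2 + t3 * g3 ^+ 2 = 0 ->
  t1 * g1 ^+ 4 + t2 * g2 ^+ 4 + t3 * g3 ^+ 4 = 0 ->
  [\/ g1 = 0, g2 = 0 | g3 = 0].
Proof.
move=> r0 r1g r2g r3g t0 t1g t2g t4g.
set k := (X in X != 0) in r2g.
(* As [r] annihilates constants and the node itself, every monic quadratic has the same moment
   [k]. *)
have interp x y : r1 * ((g1 - x) * (g1 - y)) + r2 * ((g2 - x) * (g2 - y))
    + r3 * ((g3 - x) * (g3 - y)) = k.
  have := congr1 ( *%R (x * y)) r0; have := congr1 ( *%R (x + y)) r1g.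
  by rewrite /k; lra.
have d12 : g1 - g2 != 0.
  by apply: contra_neq r2g => e; rewrite -(interp g2 g3) e; ring: e.
have d13 : g1 - g3 != 0.
  by apply: contra_neq r2g => e; rewrite -(interp g2 g3) e; ring: e.
have d23 : g2 - g3 != 0.
  by apply: contra_neq r2g => e; rewrite -(interp g1 g3) e; ring: e.
(* Applying [r] to the monic cubic with roots [g1], [g2], [g3] leaves, up to sign, [k] times the sum
   of the nodes. *)
have sum0 : g1 + g2 + g3 = 0.
  apply: (mulfI r2g); rewrite mulr0 /k.
  have := congr1 ( *%R (g1 * g2 * g3)) r0.
  have := congr1 ( *%R (g1 * g2 + g1 * g3 + g2 * g3)) r1g.
  by lra.
have interp2 x y : t1 * ((g1 ^+ 2 - x) * (g1 ^+ 2 - y))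
    + t2 * ((g2 ^+ 2 - x) * (g2 ^+ 2 - y))
    + t3 * ((g3 ^+ 2 - x) * (g3 ^+ 2 - y)) = 0.
  have := congr1 ( *%R (x * y)) t0; have := congr1 ( *%R (x + y)) t2g.
  by lra.
have [->|g1n] := eqVneq g1 0; first by constructor 1.
have [->|g2n] := eqVneq g2 0; first by constructor 2.
have [->|g3n] := eqVneq g3 0; first by constructor 3.
have e3 : g3 = - g1 - g2 by lra.
(* Since [g1 + g2 = - g3] and [g1 + g3 = - g2], the coefficient of [t1] is a product of nonzero
   factors. *)
have t10 : t1 = 0.
  have := interp2 (g2 ^+ 2) (g3 ^+ 2).
  have -> : (g1 ^+ 2 - g2 ^+ 2) * (g1 ^+ 2 - g3 ^+ 2) =
    (g1 - g2) * (g1 - g3) * g2 * g3 by rewrite e3; ring.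
  rewrite !subrr mul0r !mulr0 !addr0 => /eqP.
  rewrite !mulf_eq0 !(negPf d12, negPf d13, negPf g2n, negPf g3n).
  by rewrite !orbF => /eqP.
have t20 : t2 = 0.
  have := interp2 (g1 ^+ 2) (g3 ^+ 2).
  have -> : (g2 ^+ 2 - g1 ^+ 2) * (g2 ^+ 2 - g3 ^+ 2) =
    - ((g1 - g2) * (g2 - g3) * g1 * g3) by rewrite e3; ring.
  rewrite !subrr mul0r !mulr0 !addr0 add0r mulrN => /eqP.
  rewrite oppr_eq0 !mulf_eq0 !(negPf d12, negPf d23, negPf g1n, negPf g3n).
  by rewrite !orbF => /eqP.
have t30 : t3 = 0 by lra.
by exfalso; move: t1g; rewrite t10 t20 t30; lra.
Qed.

(** The third moment plus [x * y] times the first is [x + y] times the second, so [(x + y) * k = 0].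
    This serves [beta1] with the nodes [B1 e] and [beta3] with the nodes [B2 e], where [k] is
    [c1 / 2]. *)
Lemma symmetric_nodes (k p2 p3 x y : R) : k != 0 ->
  p2 * x + p3 * y = 0 -> p2 * x ^+ 2 + p3 * y ^+ 2 = k ->
  p2 * x ^+ 3 + p3 * y ^+ 3 = 0 ->
  [/\ x != 0, y = - x, p2 = k / (2 * x ^+ 2) & p3 = k / (2 * x ^+ 2)].
Proof.
move=> k0 h1 h2 h3.
have yE : y = - x.
  apply: (mulfI k0); rewrite -h2.
  by have := congr1 ( *%R (x * y)) h1; lra.
have x0 : x != 0.
  by apply: contra_neq k0 => x0; rewrite -h2 yE x0; ring.
have p23 : p2 = p3 by apply: (mulIf x0); move: h1; rewrite yE; lra.
by split=> //; rewrite -h2 yE -?p23; field; rewrite x0.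
Qed.

(** The second moment is [(q2 + q3) * x ^+ 2], so the weights are opposite, and the first moment
    fixes their size. This yields [beta2] and [beta4]. *)
Lemma antisymmetric_weights (q1 q2 q3 x : R) : x != 0 ->
  q1 + q2 + q3 = 0 -> q2 * x + q3 * (- x) = 1 ->
  q2 * x ^+ 2 + q3 * (- x) ^+ 2 = 0 ->
  [/\ q1 = 0, q2 = 1 / (2 * x) & q3 = - (1 / (2 * x))].
Proof.
move=> x0 h0 h1 h2.
have q23 : q2 = - q3.
  by apply: (mulIf (expf_neq0 2 x0)); move: h2; lra.
have q3E : q3 = - (1 / (2 * x)).
  transitivity (- ((q2 * x + q3 * - x) / (2 * x))); last by rewrite h1.
  by rewrite q23; field.
by split=> //; [move: h0|]; rewrite q23 ?q3E ?opprK //; lra.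
Qed.

End Nodes.

(** * Reduction of the conditions to the coefficients that vary with the family *)

Section ReducedSystem.
Variable R : realType.

(* What remains of the 59 conditions once the coefficients that do not depend
   on the family are known: [u, v], [x, y] and [f1, f2, f3] are the row sums of
   [B0], [A0] and [A2], and [w] is the last entry of [B0]. *)
Record reduced_system (c1 c2 a1 a2 a3 u v w x y : R)
    (f1 f2 f3 m1 m2 m3 n1 n2 n3 : R) : Prop := ReducedSystem {
  red_weights : a1 + a2 + a3 = 1;
  red_A0 : a2 * x + a3 * y = 1 / 2;
  red_B0 : a2 * u + a3 * v = c1 / 2;
  red_B0_sqr : a2 * u ^+ 2 + a3 * v ^+ 2 = 1 / 2;
  red_c2 : c2 * u = 0;
  red_w : a3 * w = 0;
  red_f12 : f1 = f2;
  red_f23 : f2 = f3;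
  red_A2B0_12 : m1 * u + n1 * v = m2 * u + n2 * v;
  red_A2B0_23 : m2 * u + n2 * v = m3 * u + n3 * v;
  red_A2B0_sqr : m2 * u ^+ 2 + n2 * v ^+ 2 = m3 * u ^+ 2 + n3 * v ^+ 2;
  red_A2A0 : m2 * x + n2 * y = m3 * x + n3 * y;
  red_A2_col : w * (n2 + n3 - 2 * n1) = 0
}.

(** [beta4] compares stages 2 and 3, while [beta3] compares their sum with twice stage 1. A vector
    orthogonal to both is constant over the stages; this applies to [A2 e] and to [A2 B0 e]. *)
Lemma order_two_reduced {c1 c2 c3 c4 c5 a1 a2 a3 u v w x y z : R}
    {f1 f2 f3 m1 m2 m3 n1 n2 n3 : R} :
  c1 = -1 \/ c1 = 1 -> c3 != 0 -> c4 != 0 ->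
  order_two_conditions (vec3 a1 a2 a3)
    (vec3 (c1 - c1 / (2 * c3 ^+ 2)) (c1 / (4 * c3 ^+ 2)) (c1 / (4 * c3 ^+ 2)))
    (vec3 0 (1 / (2 * c3)) (- (1 / (2 * c3))))
    (vec3 (- (c1 / (2 * c4 ^+ 2))) (c1 / (4 * c4 ^+ 2)) (c1 / (4 * c4 ^+ 2)))
    (vec3 0 (1 / (2 * c4)) (- (1 / (2 * c4))))
    (mat3 0 0 0 x 0 0 (y - z) z 0)
    (mat3 0 0 0 (c3 ^+ 2) 0 0 (c3 ^+ 2 - c2) c2 0)
    (mat3 (f1 - m1 - n1) m1 n1 (f2 - m2 - n2) m2 n2 (f3 - m3 - n3) m3 n3)
    (mat3 0 0 0 u 0 0 (v - w) w 0)
    (mat3 0 0 0 c3 0 0 (- c3) 0 0)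
    (mat3 0 0 0 (c4 + 2 * c5) (- c5) (- c5) (- c4 - 2 * c5) c5 c5)
    (const_mx 1) <->
  reduced_system c1 c2 a1 a2 a3 u v w x y f1 f2 f3 m1 m2 m3 n1 n2 n3.
Proof.
move=> c1E c3n c4n.
have c1n : c1 != 0 by case: c1E => ->; rewrite ?oppr_eq0 oner_eq0.
have c1c1 : c1 * c1 = 1 by case: c1E => ->; ring.
have b1E :
  c1 - c1 / (2 * c3 ^+ 2) + c1 / (4 * c3 ^+ 2) + c1 / (4 * c3 ^+ 2) = c1.
  by field.
have rowE (f m n : R) : f - m - n + m + n = f by ring.
have B2E2 : c4 + 2 * c5 - c5 - c5 = c4 by ring.
have B2E3 : - c4 - 2 * c5 + c5 + c5 = - c4 by ring.
split.
- case; rewrite !coordE !(b1E, rowE).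
  move=> C1 _ _ _ _ _ C7 _ _ C10.
  move=> C11 C12 _ C14 _ _ _ _ _ _.
  move=> _ C22 C23 _ C25 C26 _ _ _ C30.
  move=> _ _ C33 _ _ _ _ _ _ _.
  move=> _ _ _ _ _ _ _ _ _ _.
  move=> C51 _ _ _ _ _ _ _ _.
  have dot4 (p q : R) :
      1 / (2 * c4) * p + - (1 / (2 * c4)) * q = 0 -> p = q.
    move=> /(congr1 ( *%R (2 * c4))) E.
    by apply/eqP; rewrite -subr_eq0 -(mulr0 (2 * c4)) -E; apply/eqP; field.
  have dot3 (p q r : R) : - (c1 / (2 * c4 ^+ 2)) * p + c1 / (4 * c4 ^+ 2) * q
      + c1 / (4 * c4 ^+ 2) * r = 0 -> q + r = 2 * p.
    move=> /(congr1 ( *%R (4 * c4 ^+ 2 / c1))) E; apply/eqP.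
    rewrite -subr_eq0 -(mulr0 (4 * c4 ^+ 2 / c1)) -E; apply/eqP.
    by field; rewrite c4n.
  move/dot4: C7 => C7; move/dot4: C25 => C25; move/dot4: C30 => C30.
  move/dot4: C33 => C33; move/dot3: C14 => C14; move/dot3: C23 => C23.
  move/dot3: C51 => C51.
  split=> //; try lra.
  + by apply: (mulfI c1n); rewrite C12; field: c1c1.
  + by apply: (mulfI c1n); apply: (mulfI (invr_neq0 (expf_neq0 2 c3n))); lra.
  + by apply: (mulIf c3n); rewrite -mulrA C26 mul0r.
  + by apply: (mulIf c3n); lra.
- case=> C1 C10 C12 C11 C22 C26 f12 f23 C23 C30 C33 C25 C51.
  (* Solved for a monomial, so that [field] can use it as a rewriting rule. *)
  have C51' : w * n2 = 2 * (w * n1) - w * n3 by lra.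
  split; rewrite !coordE ?(b1E, rowE, B2E2, B2E3, C1, C10, C11, C12, f12, f23,
    C23, C30, C33, C25) //; by field: C22 C26 C51' c1c1.
Qed.
End ReducedSystem.

(** * Solution of the reduced system *)

Section Families.
Variable R : realType.

(** The quotient of the two moments is [v = 1 / c1], and [c1] is its own inverse. *)
Lemma single_node (c1 a v : R) : c1 * c1 = 1 ->
  a * v = c1 / 2 -> a * v ^+ 2 = 1 / 2 -> v = c1 /\ a = 1 / 2.
Proof.
move=> c1c1 h1 h2; have vE : v = c1.
  have : c1 / 2 * v = 1 / 2 by rewrite -h1 -h2; ring.
  move/(congr1 ( *%R (2 * c1))) => h.
  by transitivity (c1 * c1 * v); [rewrite c1c1 mul1r | lra].
split=> //; have : a * v * c1 = 1 / 2 by rewrite h1; ring: c1c1.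
by rewrite vE -mulrA c1c1; lra.
Qed.

Ltac same_coefficients :=
  split; [congr vec3 | congr mat3 | congr mat3 | congr mat3];
  rewrite ?subr0 ?subrr //; try lra.

(** The case [u = 0] gives [F1], [F2], [F3]; then [v = 0] gives [F4] to [F7], [u = v] gives [F7] to
    [F11], and distinct nonzero [u], [v] give [F7], [F10], [F12]. Further splits are on [w], on
    equality of the last two rows of [A2], and on a vanishing weight. *)
Lemma reduced_system_families (c1 c2 a1 a2 a3 u v w x y z : R)
    (f1 f2 f3 m1 m2 m3 n1 n2 n3 : R) : c1 * c1 = 1 ->
  reduced_system c1 c2 a1 a2 a3 u v w x y f1 f2 f3 m1 m2 m3 n1 n2 n3 ->
  let a := vec3 a1 a2 a3 in
  let B0 := mat3 0 0 0 u 0 0 (v - w) w 0 in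
  let A0 := mat3 0 0 0 x 0 0 (y - z) z 0 in
  let A2 := mat3 (f1 - m1 - n1) m1 n1 (f2 - m2 - n2) m2 n2
                 (f3 - m3 - n3) m3 n3 in
  family_c2_free c1 a B0 A0 A2 \/ c2 = 0 /\ family_c2_zero c1 a B0 A0 A2.
Proof.
move=> c1c1 [asum Ax Bu Bu2 c2u a3w <- <- e12 e23 e23s e23x wn] a B0 A0 A2.
have c1n : c1 != 0.
  by apply: contra_eq_neq c1c1 => ->; rewrite mul0r eq_sym oner_eq0.
have [u0|un] := eqVneq u 0.
  left; rewrite {}/a {}/B0 {}/A0 {}/A2.
  have [vE a3E] : v = c1 /\ a3 = 1 / 2.
    by apply: single_node; rewrite // -?Bu -?Bu2 u0; ring.
  have w0 : w = 0 by move: a3w; rewrite a3E; lra.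
  have n12 : n1 = n2 by apply: (mulIf c1n); move: e12; rewrite u0 vE; lra.
  have n23 : n2 = n3 by apply: (mulIf c1n); move: e23; rewrite u0 vE; lra.
  (* Either the last two rows of [A2] agree or the second row of [A0] is zero. *)
  have mx : (m2 - m3) * x = 0 by move: e23x; rewrite n23; lra.
  rewrite u0 vE w0 a3E n12 n23; rewrite a3E in asum Ax.
  move/eqP: mx; rewrite mulf_eq0 => /orP[/eqP m23|/eqP x0].
  - right; have [a20|a2n] := eqVneq a2 0; [right|left].
      rewrite a20 in asum Ax *.
      by exists (f1 - n3), m1, n3, m2, x, z; same_coefficients.
    exists (f1 - n3), m1, n3, m2, a2, y, z; split=> //; same_coefficients.
    apply: (mulfI a2n).
    have -> : a2 * ((1 - y) / (2 * a2)) = (1 - y) / 2 by field.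
    by lra.
  - left; rewrite x0 in Ax *.
    by exists (f1 - n3), m1, n3, m2, m3, a2, (y - z); same_coefficients.
have c20 : c2 = 0 by apply: (mulIf un); rewrite c2u mul0r.
right; split=> //.
have [v0|vn] := eqVneq v 0.
  have [uE a2E] : u = c1 /\ a2 = 1 / 2.
    by apply: single_node; rewrite // -?Bu -?Bu2 v0; ring.
  have m12 : m1 = m2 by apply: (mulIf un); move: e12; rewrite v0; lra.
  have m23 : m2 = m3 by apply: (mulIf un); move: e23; rewrite v0; lra.
  have ny : (n2 - n3) * y = 0 by move: e23x; rewrite m23; lra.
  rewrite {}/a {}/B0 {}/A0 {}/A2 uE v0 a2E m12 m23; rewrite a2E in asum Ax.
  have [w0|wn0] := eqVneq w 0.
    have [n23|n23] := eqVneq n2 n3.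
      right; left.
      by exists (f1 - m3), m3, n1, n3, a3, y, z; rewrite w0 n23;
        same_coefficients.
    have y0 : y = 0.
      by move/eqP: ny; rewrite mulf_eq0 subr_eq0 (negPf n23) => /eqP.
    left; rewrite y0 in Ax *.
    by exists (f1 - m3), m3, n1, n2, n3, a3, (- z); split=> //;
      rewrite w0; same_coefficients.
  have a30 : a3 = 0 by apply: (mulIf wn0); rewrite a3w mul0r.
  have nE : n2 + n3 - 2 * n1 = 0 by apply: (mulfI wn0); rewrite wn mulr0.
  rewrite a30 in asum Ax *.
  have [n23|n23] := eqVneq n2 n3.
    (* This is [F7] with third row sum [c9 = 0] in [B0]. *)
    do 3 right; left; exists (f1 - m3 - n3), m3, n3, 0, w, (y - z), z.
    by rewrite n23; same_coefficients.
  have y0 : y = 0.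
    by move/eqP: ny; rewrite mulf_eq0 subr_eq0 (negPf n23) => /eqP.
  do 2 right; left; exists (f1 - m3), m3, n1, n2, (- w), (- z).
  rewrite y0; split; last by same_coefficients.
  by apply: contra_neq n23 => n12; lra.
(* Eliminating [m2 - m3] between the linear and the quadratic condition leaves a Vandermonde factor
   on [n2 - n3]. *)
have dn : (n2 - n3) * v * (u - v) = 0.
  by have := congr1 ( *%R u) e23; lra.
have [uv|uv] := eqVneq u v.
  rewrite -uv in Bu Bu2 e12 e23 e23s.
  have [uE a23] : u = c1 /\ a2 + a3 = 1 / 2.
    by apply: single_node; rewrite // -?Bu -?Bu2; ring.
  have mn12 : m1 + n1 = m2 + n2 by apply: (mulIf un); lra.
  have mn23 : m2 + n2 = m3 + n3 by apply: (mulIf un); lra.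
  have mxy : (m2 - m3) * (x - y) = 0.
    have n23 : n2 - n3 = - (m2 - m3) by lra.
    by have := congr1 ( *%R y) n23; move: e23x; lra.
  rewrite {}/a {}/B0 {}/A0 {}/A2 -uv uE.
  have [w0|wn0] := eqVneq w 0.
    have [m23|m23] := eqVneq m2 m3.
      have [a20|a2n] := eqVneq a2 0.
        rewrite a20 in asum Ax a23 *.
        have a3E : a3 = 1 / 2 by lra.
        rewrite a3E in Ax.
        (* This is [F10] at [c10 = c1], where the quotient [c1 / c10] is 1. *)
        do 6 right; left; exists (f1 - m2 - n2), n1, m2, n2, c1, x, z.
        by split=> //; rewrite w0 divff //; same_coefficients.
      do 5 right; left; exists (f1 - m1 - n1), m1, n1, m2, a3, y, z.
      have a2E : a2 = 1 / 2 - a3 by lra.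
      split; first by apply: contra_neq a2n => a3E; lra.
      rewrite w0; same_coefficients.
      have n0 : 1 - 2 * a3 != 0 by apply: contra_neq a2n => a3E; lra.
      by apply: (mulfI n0); rewrite [RHS]mulrC divfK //;
        move: Ax; rewrite a2E; lra.
    have xy : x = y.
      apply/eqP; rewrite -subr_eq0.
      by move/eqP: mxy; rewrite mulf_eq0 (subr_eq0 m2) (negPf m23).
    have y1 : y = 1 by have := congr1 ( *%R y) a23; move: Ax; rewrite xy; lra.
    do 4 right; left; exists (f1 - m1 - n1), m1, n1, m2, m3, a3, z.
    by split=> //; rewrite w0 xy y1; same_coefficients.
  have a30 : a3 = 0 by apply: (mulIf wn0); rewrite a3w mul0r.
  have nE : n2 + n3 - 2 * n1 = 0 by apply: (mulfI wn0); rewrite wn mulr0.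
  rewrite a30 in asum Ax a23 *; have a2E : a2 = 1 / 2 by lra.
  rewrite a2E in asum Ax *.
  have [m23|m23] := eqVneq m2 m3.
    do 3 right; left; exists (f1 - m1 - n1), m1, n1, c1, w, (y - z), z.
    by same_coefficients.
  have xy : x = y.
    apply/eqP; rewrite -subr_eq0.
    by move/eqP: mxy; rewrite mulf_eq0 (subr_eq0 m2) (negPf m23).
  do 7 right; left; exists (f1 - m1 - n1), m1, n1, m2, w, z.
  split; first by apply: contra_neq m23 => m12; lra.
  by rewrite -xy; same_coefficients.
have uvn : u - v != 0 by rewrite subr_eq0.
have n23 : n2 = n3.
  move/eqP: dn; rewrite !mulf_eq0 (negPf uvn) (negPf vn).
  by rewrite !orbF subr_eq0 => /eqP.
have m23 : m2 = m3 by apply: (mulIf un); move: e23; rewrite n23; lra.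
(* A nonzero [w] forces [a3 = 0] and equal rows of [A2]: again [F7], with [v] as the parameter
   [c9]. *)
have [w0|wn0] := eqVneq w 0; last first.
  have a30 : a3 = 0 by apply: (mulIf wn0); rewrite a3w mul0r.
  have nE : n2 + n3 - 2 * n1 = 0 by apply: (mulfI wn0); rewrite wn mulr0.
  have n12 : n1 = n2 by lra.
  have m12 : m1 = m2 by apply: (mulIf un); move: e12; rewrite n12; lra.
  have [uE a2E] : u = c1 /\ a2 = 1 / 2.
    by apply: single_node; rewrite // -?Bu -?Bu2 a30; ring.
  rewrite a30 a2E in asum Ax.
  do 3 right; left; exists (f1 - m2 - n2), m2, n2, v, w, (y - z), z.
  by rewrite /a /B0 /A0 /A2 a30 a2E uE n12 m12 -n23 -m23; same_coefficients.
have m1E : m1 = m2 + (n2 - n1) * (v / u).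
  apply: (mulIf un).
  have -> : (m2 + (n2 - n1) * (v / u)) * u = m2 * u + (n2 - n1) * v by field.
  by lra.
(* Cramer's rule for [a2] and [a3], whose first two moments at the nodes [u], [v] are prescribed. *)
have a2E : a2 * (u * (u - v)) = (1 - c1 * v) / 2.
  by have := congr1 ( *%R v) Bu; lra.
have a3E : a3 * (v * (u - v)) = - ((1 - c1 * u) / 2).
  by have := congr1 ( *%R u) Bu; lra.
rewrite {}/a {}/B0 {}/A0 {}/A2 w0 -n23 -m23.
(* If [v = c1], the weight [a2] vanishes and [x] remains free, which is [F10]. *)
have [vE|vc1] := eqVneq v c1.
  have a20 : a2 = 0.
    apply: (mulIf un); apply: (mulIf uvn).
    by rewrite -mulrA a2E vE c1c1; lra.
  have a3h : a3 = 1 / 2.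
    by apply: (mulIf vn); move: Bu; rewrite a20 vE; lra.
  rewrite a20 a3h in asum Ax *.
  do 6 right; left; exists (f1 - m2 - n2), n1, m2, n2, u, x, z.
  by split=> //; rewrite -vE; same_coefficients.
have c1v : 1 - c1 * v != 0.
  apply: contra_neq vc1 => h.
  by have := congr1 ( *%R c1) h; rewrite mulrBr mulrA c1c1; lra.
have a2F : a2 = (1 - c1 * v) / 2 / (u * (u - v)).
  by rewrite -a2E mulfK // mulf_neq0.
have a3F : a3 = - ((1 - c1 * u) / 2) / (v * (u - v)).
  by rewrite -a3E mulfK // mulf_neq0.
do 8 right; exists (f1 - m2 - n2), n1, m2, n2, u, v, y, z.
have c1v' : c1 * v - 1 != 0 by rewrite -opprB oppr_eq0.
split=> //; same_coefficients.
  have -> : a1 = 1 - a2 - a3 by lra.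
  by rewrite a2F a3F; field; rewrite un vn.
(* As [c1 * v] differs from 1, [a2] is nonzero and the condition on [A0] can be solved for [x]. *)
have a2n : a2 != 0.
  by apply: contra_neq c1v => a20; move: a2E; rewrite a20; lra.
apply: (mulfI a2n).
have -> : a2 * x = 1 / 2 - a3 * y by lra.
rewrite a2F a3F; field.
by rewrite c1v' un vn uvn.
Qed.

End Families.

(** * Verification of the reduced system for each family *)

Section FamiliesConverse.
Variable R : realType.

Lemma lower_row_sums_inj (x y z x' p q : R) :
  mat3 0 0 0 x 0 0 (y - z) z 0 = mat3 0 0 0 x' 0 0 p q 0 ->
  [/\ x = x', y = p + q & z = q].
Proof. by case/mat3_inj=> _ [-> _ _] [<- -> _]; split=> //; ring. Qed.

Lemma mat3_row_sums_inj (f1 f2 f3 m1 m2 m3 n1 n2 n3 : R)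
    (b11 b12 b13 b21 b22 b23 b31 b32 b33 : R) :
  mat3 (f1 - m1 - n1) m1 n1 (f2 - m2 - n2) m2 n2 (f3 - m3 - n3) m3 n3 =
    mat3 b11 b12 b13 b21 b22 b23 b31 b32 b33 ->
  [/\ [/\ f1 = b11 + b12 + b13, f2 = b21 + b22 + b23 & f3 = b31 + b32 + b33],
      [/\ m1 = b12, m2 = b22 & m3 = b32] &
      [/\ n1 = b13, n2 = b23 & n3 = b33]].
Proof.
by case/mat3_inj=> -[<- -> ->] [<- -> ->] [<- -> ->]; repeat split; ring.
Qed.

Lemma families_reduced_system (c1 c2 a1 a2 a3 u v w x y z : R)
    (f1 f2 f3 m1 m2 m3 n1 n2 n3 : R) : c1 * c1 = 1 ->
  let a := vec3 a1 a2 a3 in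
  let B0 := mat3 0 0 0 u 0 0 (v - w) w 0 in
  let A0 := mat3 0 0 0 x 0 0 (y - z) z 0 in
  let A2 := mat3 (f1 - m1 - n1) m1 n1 (f2 - m2 - n2) m2 n2
                 (f3 - m3 - n3) m3 n3 in
  family_c2_free c1 a B0 A0 A2 \/ c2 = 0 /\ family_c2_zero c1 a B0 A0 A2 ->
  reduced_system c1 c2 a1 a2 a3 u v w x y f1 f2 f3 m1 m2 m3 n1 n2 n3.
Proof.
move=> c1c1 /=.
set goal := reduced_system _ _ _ _ _ _ _ _ _ _ _ _ _ _ _ _ _ _ _.
(* Equality of the matrices identifies all parameters, so the system need only be checked at the row
   sums and columns of the matrices of the family. *)
have E (a1' a2' a3' u' b31 b32 x' a31 a32 : R)
    (b11 b12 b13 b21 b22 b23 c31 c32 c33 : R) :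
    reduced_system c1 c2 a1' a2' a3' u' (b31 + b32) b32 x' (a31 + a32)
      (b11 + b12 + b13) (b21 + b22 + b23) (c31 + c32 + c33)
      b12 b22 c32 b13 b23 c33 ->
    [/\ vec3 a1 a2 a3 = vec3 a1' a2' a3',
        mat3 0 0 0 u 0 0 (v - w) w 0 = mat3 0 0 0 u' 0 0 b31 b32 0,
        mat3 0 0 0 x 0 0 (y - z) z 0 = mat3 0 0 0 x' 0 0 a31 a32 0 &
        mat3 (f1 - m1 - n1) m1 n1 (f2 - m2 - n2) m2 n2 (f3 - m3 - n3) m3 n3 =
        mat3 b11 b12 b13 b21 b22 b23 c31 c32 c33] -> goal.
  by move=> red [/vec3_inj[]]; rewrite /goal => -> -> ->
    /lower_row_sums_inj[-> -> ->] /lower_row_sums_inj[-> -> _]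
    /mat3_row_sums_inj[[-> -> ->] [-> -> ->] [-> -> ->]].
case=> [[|[]]|[c20 [|[|[|[|[|[|[|[|]]]]]]]]]].
- by case=> c6 [c7 [c8 [c9 [c10 [c11 [c12]]]]]]; apply: E; split; field: c1c1.
- case=> c6 [c7 [c8 [c9 [c10 [c11 [c12 [c10n]]]]]]]; apply: E.
  by split; field: c1c1.
- by case=> c6 [c7 [c8 [c9 [c10 [c11]]]]]; apply: E; split; field: c1c1.
- case=> c6 [c7 [c8 [c9 [c10 [c11 [c12 [_]]]]]]]; apply: E.
  by rewrite c20; split; field: c1c1.
- case=> c6 [c7 [c8 [c9 [c10 [c11 [c12]]]]]]; apply: E.
  by rewrite c20; split; field: c1c1.
- case=> c6 [c7 [c8 [c9 [c10 [c11 [_]]]]]]; apply: E.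
  by rewrite c20; split; field: c1c1.
- case=> c6 [c7 [c8 [c9 [c10 [c11 [c12]]]]]]; apply: E.
  by rewrite c20; split; field: c1c1.
- case=> c6 [c7 [c8 [c9 [c10 [c11 [c12 [_]]]]]]]; apply: E.
  by rewrite c20; split; field: c1c1.
- case=> c6 [c7 [c8 [c9 [c10 [c11 [c12 [c10n]]]]]]]; apply: E.
  have c10n' : 1 - 2 * c10 != 0 by apply: contra_neq c10n; lra.
  by rewrite c20; split; field: c1c1.
- case=> c6 [c7 [c8 [c9 [c10 [c11 [c12 [c10n]]]]]]]; apply: E.
  by rewrite c20; split; field: c1c1.
- case=> c6 [c7 [c8 [c9 [c10 [c11 [_]]]]]]; apply: E.
  by rewrite c20; split; field: c1c1.
- case=> c6 [c7 [c8 [c9 [c10 [c11 [c12 [c13 [[c10n c10c11 c11n c11c1]]]]]]]]].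
  apply: E.
  have d1 : c10 - c11 != 0 by rewrite subr_eq0.
  (* If [c1 * c11 = 1], then [c11 = c1], because [c1] is its own inverse. *)
  have d2 : c1 * c11 - 1 != 0.
    apply: contra_neq c11c1 => h.
    by have := congr1 ( *%R c1) h; rewrite mulrBr mulrA c1c1; lra.
  by rewrite c20; split; field: c1c1; rewrite ?c10n ?c11n ?d1 ?d2.
Qed.

End FamiliesConverse.

(** * The coefficients common to all families *)

Section CommonCoefficients.
Variable R : realType.

(** Conditions on [beta3] and [beta4] are moment equations at the nodes [B2 e]; [cond18] keeps the
    second moment of [beta3] away from 0. *)
Lemma order_two_zero_stage (a b1 b2 b3 b4 : 'cV[R]_3)
    (A0 A1 A2 B0 B1 B2 : 'M[R]_3) :
  order_two_conditions a b1 b2 b3 b4 A0 A1 A2 B0 B1 B2 (const_mx 1) ->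
  exists i, (B2 *m const_mx 1 : 'cV_3) i 0 = 0.
Proof.
case=> _ C2 C3 _ _ _ _ C8 C9 _ _ _ _ _ _ C16 _ C18 _ _ _ _ _ _ _ _ _ _ _ _
  _ _ _ _ _ _ _ _ _ _ C41 _ _ C44 _ _ _ _ _ _ _ _ _ _ _ _ _ _ _.
have [r1 [r2 [r3 b3E]]] := vec3_surj b3.
have [t1 [t2 [t3 b4E]]] := vec3_surj b4.
have [g1 [g2 [g3 gE]]] := vec3_surj (B2 *m const_mx 1).
have k0 : dotv b3 ((B2 *m const_mx 1) ⊙^ 2) != 0.
  apply: contra_eq_neq C18 => ->.
  by rewrite mulr0 mul1r eq_sym invr_eq0 pnatr_eq0.
move: C2 C3 C8 C9 C16 k0 C41 C44; rewrite gE b3E b4E !coordE.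
move=> C2 C3 C8 C9 C16 k0 C41 C44.
have [g0|g0|g0] := exists_zero_node C3 C8 k0 C41 C2 C16 C9 C44;
  [exists 0|exists 1|exists 2]; by rewrite mxE.
Qed.

(** With the zero node first, [beta1], [B1] and [beta3], [B2] pose the same moment problem. Its
    solution gives [beta2] and [beta4], then the row sums of [A1], and the conditions on [B2]
    applied to [B1 e] and its square leave only [c5] free in [B2]. *)
Lemma order_two_common (a b1 b2 b3 b4 : 'cV[R]_3)
    (A0 A1 A2 B0 B1 B2 : 'M[R]_3) :
  strictly_lower A1 -> strictly_lower B1 ->
  order_two_conditions a b1 b2 b3 b4 A0 A1 A2 B0 B1 B2 (const_mx 1) ->
  (B2 *m const_mx 1 : 'cV_3) 0 0 = 0 ->
  exists c1 c2 c3 c4 c5 : R,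
  [/\ c1 = -1 \/ c1 = 1, c3 != 0 & c4 != 0] /\
  [/\ b1 = vec3 (c1 - c1 / (2 * c3 ^+ 2)) (c1 / (4 * c3 ^+ 2))
                (c1 / (4 * c3 ^+ 2)),
      b2 = vec3 0 (1 / (2 * c3)) (- (1 / (2 * c3))),
      b3 = vec3 (- (c1 / (2 * c4 ^+ 2))) (c1 / (4 * c4 ^+ 2))
                (c1 / (4 * c4 ^+ 2)) &
      b4 = vec3 0 (1 / (2 * c4)) (- (1 / (2 * c4)))] /\
  [/\ A1 = mat3 0              0  0
                (c3 ^+ 2)      0  0
                (c3 ^+ 2 - c2) c2 0,
      B1 = mat3 0      0 0
                c3     0 0
                (- c3) 0 0 &
      B2 = mat3 0                 0      0
                (c4 + 2 * c5)     (- c5) (- c5)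
                (- c4 - 2 * c5)   c5     c5].
Proof.
move=> /strictly_lower_row_sums[x [y [c2 ->]]].
move=> /strictly_lower_row_sums[c3 [d [w ->]]].
have [p1 [p2 [p3 ->]]] := vec3_surj b1.
have [q1 [q2 [q3 ->]]] := vec3_surj b2.
have [r1 [r2 [r3 ->]]] := vec3_surj b3.
have [t1 [t2 [t3 ->]]] := vec3_surj b4.
have [g1 [c4 [g3 [m1 [m2 [m3 [n1 [n2 [n3 ->]]]]]]]]] := mat3_row_sums B2.
have rowE (f m n : R) : f - m - n + m + n = f by ring.
case=> _ C2 C3 C4 C5 C6 _ C8 C9 _ _ _ C13 _ C15 C16 C17 C18 C19 C20
  _ _ _ _ _ _ C27 _ _ _ _ _ _ _ _ _ C37 C38 _ C40 C41 _ C43 _ _ C46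
  _ _ _ _ _ _ _ _ _ _ _ C58 _.
rewrite !coordE !rowE mxE /= => g10.
move: C2 C3 C4 C5 C6 C8 C9 C13 C15 C16 C17 C18.
rewrite !coordE !rowE g10 !coordE.
move=> C2 C3 C4 C5 C6 C8 C9 C13 C15 C16 C17 C18.
move: C19 C20 C27 C37 C38 C40 C41 C43 C46 C58.
rewrite !coordE !rowE g10 !coordE.
move=> C19 C20 C27 C37 C38 C40 C41 C43 C46 C58.
set c1 := p1 + p2 + p3 in C4 C13 C17 C18.
have c1c1 : c1 * c1 = 1 by rewrite -expr2.
have c1n : c1 / 2 != 0.
  rewrite mulf_neq0 ?invr_eq0 ?pnatr_eq0 //.
  by apply: contra_eq_neq c1c1 => ->; rewrite mul0r eq_sym oner_eq0.
have divc1 (k : R) : c1 * k = 1 / 2 -> k = c1 / 2.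
  move=> h.
  by transitivity (c1 * c1 * k); [rewrite c1c1 mul1r|rewrite -mulrA h; lra].
have [c3n dE p2E p3E] := symmetric_nodes c1n C6 (divc1 _ C17) C40.
have [c4n g3E r2E r3E] := symmetric_nodes c1n C8 (divc1 _ C18) C41.
rewrite dE in C15 C37; rewrite g3E in C16 C9.
have [q10 q2E q3E] := antisymmetric_weights c3n C5 C15 C37.
have [t10 t2E t3E] := antisymmetric_weights c4n C2 C16 C9.
have weightE (k : R) : k != 0 -> c1 / 2 / (2 * k ^+ 2) = c1 / (4 * k ^+ 2).
  by move=> kn; field.
rewrite weightE // in p2E p3E; rewrite weightE // in r2E r3E.
have p3n : p3 != 0.
  apply: contra_neq c1n => p30; have -> : c1 / 2 = 2 * c3 ^+ 2 * p3.
    by rewrite p3E; field.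
  by rewrite p30 mulr0.
have r3n : r3 != 0.
  apply: contra_neq c1n => r30; have -> : c1 / 2 = 2 * c4 ^+ 2 * r3.
    by rewrite r3E; field.
  by rewrite r30 mulr0.
have p23 : p2 = p3 by rewrite p2E p3E.
have r23 : r2 = r3 by rewrite r2E r3E.
have r1E : r1 = - 2 * r3 by lra.
have w0 : w = 0.
  by apply: (mulfI p3n); apply: (mulIf c3n); rewrite -mulrA C19; ring.
have tc4 : t2 * c4 = 1 / 2 by rewrite t2E; field.
(* The opposite weights of [beta2] equate the last two row sums of [A1]. *)
have xy : x = y.
  apply: (mulfI (invr_neq0 c3n)); apply/eqP; rewrite -subr_eq0; apply/eqP.
  transitivity (2 * (q2 * x + q3 * y)); first by rewrite q2E q3E; field.
  by rewrite C27 mulr0.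
have xE : x = c3 ^+ 2.
  apply: (mulfI p3n); transitivity (c1 / 4).
    by have := divc1 _ C13; rewrite p23 -xy; lra.
  by rewrite p3E; field.
have t32 : t3 = - t2 by lra.
have t2n : t2 != 0.
  by apply/eqP => t20; move: tc4; rewrite t20; lra.
rewrite dE in C20 C38 C43 C46 C58.
rewrite t10 t32 g3E in C38 C46 C58; rewrite r1E r23 in C20 C43.
(* As [B1 e] is [(0, c3, - c3)], the vector [B2 B1 e] is [c3] times the difference of the last two
   columns of [B2]; [cond20], [cond38] and [cond46] make it vanish. *)
have mn : [/\ m1 = n1, m2 = n2 & m3 = n3].
  have h23 : m2 - n2 = m3 - n3.
    by apply: (mulfI t2n); apply: (mulIf c3n); lra.
  have h12 : 2 * (m1 - n1) = m2 - n2 + (m3 - n3).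
    by apply: (mulfI r3n); apply: (mulIf c3n); lra.
  have h0 : m2 - n2 + (m3 - n3) = 0.
    have tc4n : t2 * c4 != 0 by rewrite mulf_neq0.
    by apply: (mulfI tc4n); apply: (mulIf c3n); lra.
  by split; lra.
case: mn => m1E m2E m3E; rewrite -m1E -m2E -m3E in C43 C58.
(* Applied to the square of [B1 e], [B2] now gives [2 * c3 ^+ 2] times its common last column,
   constrained by [cond58] and [cond43]. *)
have m23 : m2 + m3 = 0.
  have tc4n : t2 * c4 != 0 by rewrite mulf_neq0.
  by apply: (mulfI tc4n); apply: (mulIf (expf_neq0 2 c3n)); lra.
have m10 : m1 = 0.
  suff : 2 * m1 = m2 + m3 by lra.
  by apply: (mulfI r3n); apply: (mulIf (expf_neq0 2 c3n)); lra.
exists c1, c2, c3, c4, m3; split.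
  split=> //; move/eqP: c1c1; rewrite -expr2 sqrf_eq1.
  by move=> /orP[] /eqP ->; [right|left].
split; split.
- congr vec3=> //; have -> : p1 = c1 - 2 * p3 by rewrite /c1 p23; ring.
  by rewrite p3E; field.
- by rewrite q10 q2E q3E.
- by congr vec3=> //; rewrite r1E r3E; field.
- by rewrite t10 t2E t3E.
- by rewrite -xy xE.
- by rewrite w0 dE subr0.
- by rewrite -m1E -m2E -m3E g3E; congr mat3; lra.
Qed.

End CommonCoefficients.

(** * Assembly of the two directions of the classification *)

Theorem mainTheorem3 (R : realType) (M : srk R 3) (hM : explicit_srk M) :
  order_two M <-> exists p : 'S_3, classified_form (relabel3 p M).
Proof.
have sqr1 (c1 : R) : c1 = -1 \/ c1 = 1 -> c1 * c1 = 1 by case=> ->; ring.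
case: hM => lowA0 lowA1 lowB0 lowB1.
split=> [o2M | [p [c1 [c2 [c3 [c4 [c5 [[c1E c3n c4n]]]]]]]]].
  have [i gi0] := order_two_zero_stage o2M.
  (* The transposition brings the stage with zero node to the first place. *)
  pose p := tperm 0 i; exists p.
  have o2 : order_two (relabel3 p M) by apply/order_two_relabel3.
  have g0 : (B2 (relabel3 p M) *m const_mx 1 : 'cV_3) 0 0 = 0.
    by rewrite mulmx_row_perm mxE tpermL.
  have [c1 [c2 [c3 [c4 [c5 [c_ok [bE mE]]]]]]] :=
    order_two_common (lowA1 : strictly_lower (A1 (relabel3 p M))) lowB1 o2 g0.
  exists c1, c2, c3, c4, c5; split=> //; split=> //; split=> //.
  case: c_ok bE mE o2 => c1E c3n c4n [E1 E2 E3 E4] [E5 E6 E7].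
  rewrite /order_two E1 E2 E3 E4 E5 E6 E7 /=.
  have [a1 [a2 [a3 ->]]] := vec3_surj (alpha M).
  have [u [v [w ->]]] := strictly_lower_row_sums lowB0.
  have [x [y [z ->]]] := strictly_lower_row_sums lowA0.
  have [f1 [f2 [f3 [m1 [m2 [m3 [n1 [n2 [n3 ->]]]]]]]]] :=
    mat3_row_sums (row_perm p (A2 M)).
  move=> /(order_two_reduced c1E c3n c4n).
  by apply: reduced_system_families; apply: sqr1.
move=> [[E1 E2 E3 E4] [[E5 E6 E7] fam]]; apply/(order_two_relabel3 p).
move: fam; rewrite /order_two E1 E2 E3 E4 E5 E6 E7 /=.
have [a1 [a2 [a3 ->]]] := vec3_surj (alpha M).
have [u [v [w ->]]] := strictly_lower_row_sums lowB0.
have [x [y [z ->]]] := strictly_lower_row_sums lowA0.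
have [f1 [f2 [f3 [m1 [m2 [m3 [n1 [n2 [n3 ->]]]]]]]]] :=
  mat3_row_sums (row_perm p (A2 M)).
move=> /(families_reduced_system (sqr1 _ c1E)) red.
by apply/order_two_reduced.
Qed.
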